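(* Let $M$ be a smooth manifold, $\eta\in\Omega^1(M)$, and $r\ge 0$ an integer. (i) $\eta$ is a precontact form of class $2r+1$ if, and only if, at every point of $M$, $$\eta\wedge(d\eta)^r\neq 0,\qquad (d\eta)^{r+1}=0.$$ (ii) $\eta$ is a precontact form of class $2r+2$ if, and only if, at every point of $M$, $$\eta\neq 0,\qquad \eta\wedge(d\eta)^{r+1}=0,\qquad (d\eta)^{r+1}\neq 0.$$
   Context: The class of a 1-form $\eta$ at $x$ is the codimension in $T_xM$ of $\operatorname{Ker}\eta_x\cap\operatorname{Ker}(d\eta)_x$, where $\operatorname{Ker}\alpha_x=\{v\in T_xM\mid\iota_v\alpha_x=0\}$. A 1-form $\eta$ is a precontact form if it is nowhere-vanishing and its class is constant on $M$. $(d\eta)^r$ denotes the exterior product of $r$ copies of $d\eta$ (with $(d\eta)^0=1$). *)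

(* Defs.v *)
From HB Require Import structures.
From mathcomp Require Import all_boot all_order all_algebra all_fingroup.
From mathcomp Require Import all_classical all_reals all_analysis.
Set Implicit Arguments.
Unset Strict Implicit.
Unset Printing Implicit Defensive.
Import Order.TTheory GRing.Theory Num.Theory.
Import numFieldNormedType.Exports.
Local Open Scope classical_set_scope.
Local Open Scope ring_scope.

(* The library has no manifolds, so they are built here on MathComp-Analysis:
   Hausdorff second countable spaces with a smooth atlas.  The tangent space at
   x is the model space R^n, read in a chart chosen once and for all at x; the
   derivatives of the transition maps identify it with the readings in the other
   charts. *)

Section Smooth.
Context {R : realType} {V W : normedModType R}.

(* For O open and V of finite dimension this is the usual C^k: having continuous
   partial derivatives up to order k. *)
Fixpoint Ck_on (k : nat) (O : set V) (f : V -> W) : Prop :=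
  match k with
  | 0 => forall y, O y -> {for y, continuous f}
  | k'.+1 => (forall y, O y -> differentiable f y) /\
             (forall v : V, Ck_on k' O (fun y => 'd f y v))
  end.

Definition smooth_on (O : set V) (f : V -> W) : Prop := forall k, Ck_on k O f.

End Smooth.

(* [chart_map] and [chart_inv] are total functions, but only their values on
   [chart_dom] and on its image are meaningful. *)
Record chart (R : realType) (n : nat) (T : topologicalType) := Chart {
  chart_dom : set T;
  chart_map : T -> 'rV[R]_n;
  chart_inv : 'rV[R]_n -> T;
  chart_dom_open : open chart_dom;
  chart_img_open : open (chart_map @` chart_dom);
  chart_mapK : forall x, chart_dom x -> chart_inv (chart_map x) = x;
  chart_map_continuous :
    forall x, chart_dom x -> {for x, continuous chart_map};
  chart_inv_continuous :
    forall y, (chart_map @` chart_dom) y -> {for y, continuous chart_inv}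
}.

Record smooth_manifold (R : realType) (n : nat) := SmoothManifold {
  carrier :> topologicalType;
  manifold_hausdorff : hausdorff_space carrier;
  manifold_second_countable : @second_countable carrier;
  atlas : set (chart R n carrier);
  atlas_cover : forall x : carrier, exists2 a, atlas a & chart_dom a x;
  atlas_smooth : forall a b, atlas a -> atlas b ->
    smooth_on (chart_map a @` (chart_dom a `&` chart_dom b))
              (chart_map b \o chart_inv a)
}.

Section Tensors.
Context {R : realType}.

(* Covariant k-tensors, as bare functions of k vectors; the exterior k-forms are
   the multilinear alternating ones, and the operations below are the usual ones
   on these. *)
Definition tensor (V : vectType R) (k : nat) := ('I_k -> V) -> R.

Context {V : vectType R}.

(* Normalized so that (a ^ b)(u, v) = a(u) b(v) - a(v) b(u) for 1-forms. *)
Definition wedge (p q : nat) (a : tensor V p) (b : tensor V q) :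
    tensor V (p + q) :=
  fun v => (p`! * q`!)%:R^-1 *
    \sum_(s : 'S_(p + q)) (-1) ^+ s *
      (a (fun i => v (s (lshift q i))) * b (fun j => v (s (rshift p j)))).

(* The recursive call is well typed because r.+1 * p computes to p + r * p. *)
Fixpoint wedge_pow (p : nat) (a : tensor V p) (r : nat) : tensor V (r * p) :=
  match r return tensor V (r * p) with
  | 0 => fun=> 1
  | r'.+1 => wedge a (@wedge_pow p a r')
  end.

Definition interior (k : nat) (v : V) (a : tensor V k.+1) : tensor V k :=
  fun w => a (fun i => oapp w v (unlift ord0 i)).

Definition tensor_ker (k : nat) (a : tensor V k.+1) : set V :=
  [set v | interior v a = 0].

Definition has_codim (A : set V) (c : nat) : Prop :=
  exists2 U : {vspace V}, A = [set v | v \in U] & (\dim U + c = \dim {:V})%N.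

End Tensors.

Arguments wedge_pow {R V p} a r v.

Section Forms.
Context {R : realType} {n : nat}.

Definition chart_at (M : smooth_manifold R n) (x : M) : chart R n M :=
  sval (cid2 (atlas_cover x)).

Definition tangent (M : smooth_manifold R n) (x : M) : vectType R := 'rV[R]_n.

(* [local_expr w a y] is the pullback of w along [chart_inv a] at y: the
   derivative of the transition from the chart a to the chart chosen at
   [chart_inv a y] turns a vector of R^n into a tangent vector at that point. *)
Definition local_expr (M : smooth_manifold R n)
    (w : forall x : M, {scalar tangent x})
    (a : chart R n M) (y v : 'rV[R]_n) : R :=
  w (chart_inv a y) ('d (chart_map (chart_at (chart_inv a y)) \o chart_inv a) y v).

Record one_form (M : smooth_manifold R n) := OneForm {
  form_at :> forall x : M, {scalar tangent x};
  form_smooth : forall a, atlas a -> forall v : 'rV[R]_n,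
    smooth_on (chart_map a @` chart_dom a)
              (fun y => local_expr form_at a y v : R^o)
}.

Context {M : smooth_manifold R n}.

Definition form_tensor (eta : one_form M) (x : M) : tensor (tangent x) 1 :=
  fun v => eta x (v ord0).
Arguments form_tensor eta x v : clear implicits.

(* d(eta)(u, v) = D_u (eta(v)) - D_v (eta(u)) for u, v constant in a chart, that
   is sum_(i, j) (d_i eta_j - d_j eta_i) u_i v_j, computed in the chart that
   defines the tangent space at x. *)
Definition ext_deriv (eta : one_form M) (x : M) : tensor (tangent x) 2 :=
  fun v =>
    let a := chart_at x in
    let D (u w : 'rV[R]_n) : R :=
      'd (fun y => local_expr eta a y w : R^o) (chart_map a x) u in
    D (v ord0) (v ord_max) - D (v ord_max) (v ord0).
Arguments ext_deriv eta x v : clear implicits.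

Definition has_class (eta : one_form M) (x : M) (c : nat) : Prop :=
  has_codim (tensor_ker (form_tensor eta x) `&` tensor_ker (ext_deriv eta x)) c.

Definition precontact (eta : one_form M) : Prop :=
  (forall x : M, form_tensor eta x <> 0) /\
  (exists c, forall x : M, has_class eta x c).

Definition precontact_of_class (eta : one_form M) (c : nat) : Prop :=
  precontact eta /\ forall x : M, has_class eta x c.

End Forms.

Arguments form_tensor {R n M} eta x v.
Arguments ext_deriv {R n M} eta x v.

(* Main.v *)
Require Import Defs.
From HB Require Import structures.
From mathcomp Require Import all_boot all_order all_algebra all_fingroup.
From mathcomp Require Import all_classical all_reals all_analysis.
From mathcomp Require Import ring.
Import Order.TTheory GRing.Theory Num.Theory.
Import numFieldNormedType.Exports.
Set Implicit Arguments.
Unset Strict Implicit.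
Local Open Scope ring_scope.

(** Both equivalences are pointwise facts about a linear form alpha = eta_x and
a skew-symmetric bilinear form w = (d eta)_x on V = T_x M.  Let m be the largest
integer with w^m <> 0 and let K be the common kernel of alpha and w.  Everything
follows from one dichotomy ([has_codim_kernel]): the codimension of K is 2m + 1
if alpha ^ w^m <> 0, and 2m if alpha ^ w^m = 0.

An alternating form of degree d that is killed by the contraction with every
vector of K vanishes as soon as d exceeds the codimension of K
([form_eq0_of_dim]); applied to w^m and to alpha ^ w^m this bounds the
codimension from below.  For the upper bound, pick vectors s with w^m(s) <> 0.
Contracting w^(m+1) = 0 with x gives (m+1) w_x ^ w^m = 0, where w_x = w(x, .),
and evaluating this on (y, s), for an x that is w-orthogonal to s, leaves
w(x, y) w^m(s) = 0.  So the 2m equations w(x, s_i) = 0 already cut out the kernel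
of w ([form_rank_kernel]).  The form alpha adds one more equation, unless
alpha ^ w^m = 0: contracting that identity with x in the kernel of w gives
alpha(x) w^m = 0, so that alpha vanishes there.  No normal form of the pair
(alpha, w) is involved.

Given the dichotomy, (i) says that m = r and alpha ^ w^m <> 0, and (ii) that
m = r + 1 and alpha ^ w^m = 0.  The one further input, for the converse in (ii),
is that alpha <> 0 and alpha ^ w^k = 0 imply w^(k+1) = 0
([ext1_form_pow_eq0]), which identifies m with r + 1.

The computations are made with forms on finite sequences of vectors, where the
products by a 1-form and by a 2-form are defined by recursion through the
derivation rules of contractions; the degree is then the length of the sequence
and no reindexing is needed.  [wedge_ext1] and [wedge_ext2] identify these
products with the sums over permutations.  The rest is the bilinearity of the
exterior derivative, which comes from the differentiability of eta in charts. *)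

(** * Exterior multiplication on sequences of vectors *)

Section SequenceForms.
Context {R : comNzRingType} {V : lmodType R}.
Implicit Types (F G : seq V -> R) (theta phi : V -> R) (w : V -> V -> R).
Implicit Types (s t : seq V).

Definition contr x F : seq V -> R := fun s => F (x :: s).

(** The product theta ^ F, defined by the rule
i_x (theta ^ F) = theta(x) F - theta ^ i_x F. *)
Fixpoint ext1 theta F s : R :=
  if s is x :: s' then theta x * F s' - ext1 theta (contr x F) s' else 0.

(** The product w ^ F with a 2-form, defined by the rule
i_x (w ^ F) = w_x ^ F + w ^ i_x F. *)
Fixpoint ext2 w F s : R :=
  if s is x :: s' then ext1 (w x) F s' + ext2 w (contr x F) s' else 0.

Definition unit_form s : R := (nilp s)%:R.

Definition form_pow w k : seq V -> R := iter k (ext2 w) unit_form.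

Lemma ext1_linr theta c F G s :
  ext1 theta (fun t => c * F t + G t) s = c * ext1 theta F s + ext1 theta G s.
Proof.
elim: s F G => [|x s IHs] F G /=; first by rewrite mulr0 addr0.
rewrite (IHs (contr x F) (contr x G)); ring.
Qed.

Lemma ext1_linl a theta phi F s :
  ext1 (fun z => a * theta z + phi z) F s = a * ext1 theta F s + ext1 phi F s.
Proof.
elim: s F => [|x s IHs] F /=; first by rewrite mulr0 addr0.
rewrite IHs; ring.
Qed.

Lemma ext1_0r theta s : ext1 theta (fun=> 0) s = 0.
Proof. by elim: s => //= x s ->; rewrite mulr0 subr0. Qed.

Lemma ext1Zr theta c F s : ext1 theta (fun t => c * F t) s = c * ext1 theta F s.
Proof.
elim: s F => [|x s IHs] F /=; first by rewrite mulr0.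
rewrite (IHs (contr x F)); ring.
Qed.

Lemma ext1_eq0 theta F s : {in s, forall x, theta x = 0} -> ext1 theta F s = 0.
Proof.
elim: s F => //= x s IHs F th0.
rewrite th0 ?mem_head// mul0r IHs ?subr0// => y ys.
by rewrite th0// inE ys orbT.
Qed.

Lemma ext2_linr w c F G s :
  ext2 w (fun t => c * F t + G t) s = c * ext2 w F s + ext2 w G s.
Proof.
elim: s F G => [|x s IHs] F G /=; first by rewrite mulr0 addr0.
rewrite ext1_linr (IHs (contr x F) (contr x G)); ring.
Qed.

Lemma ext2_0r w s : ext2 w (fun=> 0) s = 0.
Proof. by elim: s => //= x s ->; rewrite ext1_0r addr0. Qed.

Lemma ext2Zr w c F s : ext2 w (fun t => c * F t) s = c * ext2 w F s.
Proof.
have := ext2_linr w c F (fun=> 0) s; rewrite ext2_0r addr0 => <-.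
by congr (ext2 w _ s); apply/funext => t; rewrite addr0.
Qed.

Lemma ext1_contr theta phi F x s :
  ext1 theta (contr x (ext1 phi F)) s =
  phi x * ext1 theta F s - ext1 theta (ext1 phi (contr x F)) s.
Proof.
have -> : contr x (ext1 phi F) =
    fun t => phi x * F t + (-1 * ext1 phi (contr x F) t).
  by apply/funext => t; rewrite mulN1r.
by rewrite ext1_linr ext1Zr mulN1r.
Qed.

Lemma ext1_anticomm theta phi F s :
  ext1 theta (ext1 phi F) s = - ext1 phi (ext1 theta F) s.
Proof.
elim: s F => [|x s IHs] F /=; first by rewrite oppr0.
rewrite !ext1_contr IHs; ring.
Qed.

Lemma ext2_ext1 w theta F s : ext2 w (ext1 theta F) s = ext1 theta (ext2 w F) s.
Proof.
elim: s F => [|x s IHs] F //=.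
have -> : contr x (ext1 theta F) =
    fun t => (-1) * ext1 theta (contr x F) t + theta x * F t.
  by apply/funext => t; rewrite mulN1r addrC.
have -> : contr x (ext2 w F) = fun t => 1 * ext1 (w x) F t + ext2 w (contr x F) t.
  by apply/funext => t; rewrite mul1r.
rewrite ext2_linr ext2Zr ext1_linr IHs (ext1_anticomm (w x)); ring.
Qed.

(** The derivation rule i_x w^(k+1) = (k+1) w_x ^ w^k; it needs w ^ _ to commute
with w_x ^ _. *)
Lemma contr_form_pow w k x s :
  form_pow w k.+1 (x :: s) = k.+1%:R * ext1 (w x) (form_pow w k) s.
Proof.
elim: k s => [|k IHk] s.
  by rewrite /= (_ : contr x unit_form = fun=> 0)// ext2_0r addr0 mul1r.
rewrite [LHS]/=.
have -> : contr x (ext2 w (iter k (ext2 w) unit_form)) =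
    fun t => k.+1%:R * ext1 (w x) (form_pow w k) t.
  by apply/funext => t; rewrite -IHk.
by rewrite ext2Zr ext2_ext1 -[k.+2%:R]natr1 mulrDl mul1r addrC.
Qed.

Lemma ext1_size theta F k : (forall s, size s != k -> F s = 0) ->
  forall s, size s != k.+1 -> ext1 theta F s = 0.
Proof.
move=> F0 s; elim: s k F F0 => //= x s IHs k F F0; rewrite eqSS => sk.
rewrite F0// mulr0 sub0r; apply/eqP; rewrite oppr_eq0; apply/eqP.
case: k F0 sk => [|k] F0 sk.
  by rewrite (_ : contr x F = fun=> 0) ?ext1_0r//; apply/funext => t; apply: F0.
by apply: (IHs k) => // t tk; apply: F0; rewrite /= eqSS.
Qed.

Lemma ext2_size w F k : (forall s, size s != k -> F s = 0) ->
  forall s, size s != k.+2 -> ext2 w F s = 0.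
Proof.
move=> F0 s; elim: s k F F0 => //= x s IHs k F F0; rewrite eqSS => sk.
rewrite (ext1_size _ F0)// add0r.
case: k F0 sk => [|k] F0 sk.
  by rewrite (_ : contr x F = fun=> 0) ?ext2_0r//; apply/funext => t; apply: F0.
by apply: (IHs k) => // t tk; apply: F0; rewrite /= eqSS.
Qed.

Lemma form_pow_size w k s : size s != (k * 2)%N -> form_pow w k s = 0.
Proof.
elim: k s => [|k IHk] s; first by case: s.
exact: ext2_size.
Qed.

Definition antisymmetric_form F := forall s x y t,
  F (s ++ x :: y :: t) = - F (s ++ y :: x :: t).

Definition multilinear_form F := forall s a x y t,
  F (s ++ (a *: x + y) :: t) = a * F (s ++ x :: t) + F (s ++ y :: t).

Lemma antisymmetric_contr F x : antisymmetric_form F -> antisymmetric_form (contr x F).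
Proof. by move=> F_alt s; apply: (F_alt (x :: s)). Qed.

Lemma multilinear_contr F x : multilinear_form F -> multilinear_form (contr x F).
Proof. by move=> F_lin s; apply: (F_lin (x :: s)). Qed.

Lemma contr_anticomm F x y : antisymmetric_form F ->
  contr y (contr x F) = fun t => -1 * contr x (contr y F) t.
Proof. by move=> F_alt; apply/funext => t; rewrite mulN1r; apply: (F_alt [::]). Qed.

Lemma antisymmetric_ext1 theta F :
  antisymmetric_form F -> antisymmetric_form (ext1 theta F).
Proof.
move=> F_alt s x y t; elim: s F F_alt => [|z s IHs] F F_alt /=.
  rewrite (@contr_anticomm F) // ext1Zr /contr; ring.
by rewrite F_alt (IHs (contr z F)); [ring | exact: antisymmetric_contr].
Qed.

Lemma antisymmetric_ext2 w F : (forall x y, w x y = - w y x) ->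
  antisymmetric_form F -> antisymmetric_form (ext2 w F).
Proof.
move=> w_alt F_alt s x y t; elim: s F F_alt => [|z s IHs] F F_alt /=.
  rewrite (@contr_anticomm F) // ext2Zr (w_alt y x); ring.
rewrite (antisymmetric_ext1 _ F_alt) (IHs (contr z F)).
  ring.
exact: antisymmetric_contr.
Qed.

Lemma multilinear_ext1 (theta : {scalar V}) F :
  multilinear_form F -> multilinear_form (ext1 theta F).
Proof.
move=> F_lin s a x y t; elim: s F F_lin => [|z s IHs] F F_lin /=.
  have -> : contr (a *: x + y) F = fun t => a * contr x F t + contr y F t.
    by apply/funext => u; apply: (F_lin [::]).
  rewrite linearP ext1_linr /=; ring.
rewrite F_lin (IHs (contr z F)); [ring | exact: multilinear_contr].
Qed.

Lemma multilinear_ext2 w F : (forall y, scalar (w^~ y)) -> (forall x, scalar (w x)) ->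
  multilinear_form F -> multilinear_form (ext2 w F).
Proof.
move=> w_linl w_linr F_lin s a x y t; elim: s F F_lin => [|z s IHs] F F_lin /=.
  have -> : contr (a *: x + y) F = fun t => a * contr x F t + contr y F t.
    by apply/funext => u; apply: (F_lin [::]).
  have -> : w (a *: x + y) = fun z => a * w x z + w y z.
    by apply/funext => z; apply: w_linl.
  rewrite ext1_linl ext2_linr; ring.
pose wz : {scalar V} := HB.pack (w z) (GRing.isLinear.Build _ _ _ _ (w z) (w_linr z)).
rewrite (@multilinear_ext1 wz F F_lin) (IHs (contr z F)) /=.
  ring.
exact: multilinear_contr.
Qed.

End SequenceForms.

(** * Sums over permutations *)

Lemma codomS (T : Type) n (v : 'I_n.+1 -> T) :
  codom v = v ord0 :: codom (v \o lift ord0).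
Proof. by rewrite !codomE enum_ordSl /= -map_comp. Qed.

Lemma codom_ord0 (T : Type) (v : 'I_0 -> T) : codom v = [::].
Proof. by apply: size0nil; rewrite size_codom card_ord. Qed.

(** A permutation of n + 1 points is determined by the image j of the first one
and by the permutation it induces on the others.  This is what turns sums over
permutations into iterated cofactor expansions. *)
Lemma lift_perm_bij n :
  bijective (fun p : 'I_n.+1 * 'S_n => lift_perm ord0 p.1 p.2).
Proof.
apply: inj_card_bij; last by rewrite card_prod !card_ord !card_Sn factS.
move=> [i s] [j t] /= st.
have ij : i = j by rewrite -(lift_perm_id ord0 i s) st lift_perm_id.
rewrite -{j}ij in st *; congr (_, _); apply/permP => k.
by apply: (@lift_inj _ i); rewrite -!(lift_perm_lift ord0) st.
Qed.

Lemma sum_perm_lift (A : nmodType) n (f : 'S_n.+1 -> A) :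
  \sum_s f s = \sum_j \sum_(t : 'S_n) f (lift_perm ord0 j t).
Proof. by rewrite (reindex _ (onW_bij _ (lift_perm_bij n))) pair_bigA. Qed.

Lemma lift_lift0 n (j : 'I_n.+1) (k : 'I_n) :
  lift (lift ord0 j) (lift ord0 k) = lift ord0 (lift j k).
Proof. by apply: val_inj; rewrite /= /bump !leq0n ltnS; case: leqP. Qed.

Lemma lift_lift_ord0 n (j : 'I_n.+1) : lift (lift ord0 j) ord0 = ord0.
Proof. exact: val_inj. Qed.

Section CodomForms.
Context {R : comNzRingType} {V : lmodType R}.
Implicit Types (F : seq V -> R).

Lemma codom_liftS n (v : 'I_n.+2 -> V) j :
  codom (v \o lift (lift ord0 j)) = v ord0 :: codom (v \o lift ord0 \o lift j).
Proof.
rewrite codomS /= lift_lift_ord0; congr (_ :: _).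
by apply: eq_codom => k /=; rewrite lift_lift0.
Qed.

Lemma antisymmetric_front F n (v : 'I_n.+1 -> V) j : antisymmetric_form F ->
  F (v j :: codom (v \o lift j)) = (-1) ^+ j * F (codom v).
Proof.
elim: n F v j => [|n IHn] F v j F_alt; case: (unliftP ord0 j) => [k|] ->.
- by case: k.
- by rewrite codomS mul1r.
- rewrite codom_liftS (F_alt [::]) /= [codom v]codomS.
  by rewrite -[F (v ord0 :: _)]/(contr (v ord0) F _)
    (IHn _ (v \o lift ord0)) ?exprS ?mulN1r ?mulNr//; exact: antisymmetric_contr.
- by rewrite codomS mul1r.
Qed.

(** Invariance under adjacent transpositions is enough: the entry that a
permutation puts first is moved there by adjacent swaps, and the remaining
entries are treated by induction on the contracted form. *)
Lemma antisymmetric_perm F n (v : 'I_n -> V) (s : 'S_n) : antisymmetric_form F ->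
  F (codom (v \o s)) = (-1) ^+ s * F (codom v).
Proof.
elim: n F v s => [|n IHn] F v s F_alt.
  rewrite !codom_ord0 (_ : s = 1%g) ?odd_perm1 ?mul1r//.
  by apply/permP => -[].
have [g _ gK] := lift_perm_bij n; rewrite -(gK s); case: (g s) => j t /=.
rewrite odd_lift_perm [codom (v \o _)]codomS /= lift_perm_id.
rewrite (_ : codom _ = codom ((v \o lift j) \o t)); last first.
  by apply: eq_codom => k /=; rewrite lift_perm_lift.
rewrite -[F (_ :: _)]/(contr _ F _) IHn; last exact: antisymmetric_contr.
rewrite /contr antisymmetric_front // mulrA; congr (_ * _).
by rewrite signr_addb mulrC signr_odd.
Qed.

Lemma ext1_codom theta F n (v : 'I_n.+1 -> V) :
  ext1 theta F (codom v) =
  \sum_(j < n.+1) (-1) ^+ j * (theta (v j) * F (codom (v \o lift j))).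
Proof.
elim: n F v => [|n IHn] F v; rewrite codomS big_ord_recl mul1r /=.
  by rewrite big_ord0 codom_ord0 /= subr0 addr0.
congr (_ + _); rewrite IHn -sumrN; apply: eq_bigr => j _ /=.
by rewrite exprS mulN1r mulNr codom_liftS.
Qed.

(** The double sum runs over ordered pairs of arguments while each unordered
pair occurs once in w ^ F, whence the factor 2; the two orders agree by the
skew-symmetry of w. *)
Lemma ext2_codom w F n (v : 'I_n.+2 -> V) : (forall x y, w x y = - w y x) ->
  ext2 w F (codom v) *+ 2 =
  \sum_(j < n.+2) \sum_(k < n.+1) (-1) ^+ (j + k) *
    (w (v j) (v (lift j k)) * F (codom (v \o lift j \o lift k))).
Proof.
move=> w_alt; elim: n F v => [|n IHn] F v; rewrite codomS big_ord_recl /=.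
(* The pairs with j = 0, and those with k-th remaining argument v_0, each sum up
   to w_(v_0) ^ F; the other pairs are those of the contraction with v_0. *)
all: under [X in _ = _ + X]eq_bigr => j _ do rewrite big_ord_recl.
all: rewrite big_split /= addrA mulrnDl; congr (_ + _).
1,3: rewrite mulr2n ext1_codom; congr (_ + _); apply: eq_bigr => j _.
1,2: rewrite lift_lift_ord0 w_alt /bump leq0n addn0 exprS mulN1r !mulNr.
1,2: rewrite !mulrN; congr (- _).
1,2: congr (_ * (_ * F _)); apply: eq_codom => k /=; congr v.
1,2: by rewrite lift_lift0.
- by rewrite codomS codom_ord0 /= addr0 mul0rn big1// => j _; rewrite big_ord0.
- rewrite IHn; apply: eq_bigr => j _; apply: eq_bigr => k _.
  rewrite /bump !leq0n !addSn addnS !exprS !mulN1r opprK lift_lift0.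
  congr (_ * (_ * _)); rewrite [in RHS]codomS /= lift_lift_ord0 /contr.
  congr (F (_ :: _)).
    by rewrite lift_lift_ord0.
  by apply: eq_codom => i /=; rewrite !lift_lift0.
Qed.

End CodomForms.

(** * Comparison with the wedge product *)

Section WedgeSequence.
Context {R : realType} {V : vectType R}.
Implicit Types (F : seq V -> R).

(** The q! permutations with a given first value contribute the same term, since
F is antisymmetric; this cancels the normalization of the wedge product. *)
Lemma wedge_ext1 (theta : V -> R) F q (b : tensor V q) (v : 'I_(1 + q) -> V) :
  antisymmetric_form F -> (forall u, b u = F (codom u)) ->
  wedge (fun u : 'I_1 -> V => theta (u ord0)) b v = ext1 theta F (codom v).
Proof.
move=> F_alt bE; have q0 : (q`!)%:R != 0 :> R by rewrite pnatr_eq0 -lt0n fact_gt0.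
rewrite /wedge mul1n (@ext1_codom _ _ _ _ q) (@sum_perm_lift R q).
apply: (mulfI q0); rewrite mulrA divff // mul1r mulr_sumr.
apply: eq_bigr => j _; rewrite -card_Sn mulr_natl -sumr_const.
apply: eq_big => [t | t _]; first by rewrite inE.
rewrite bE.
rewrite (_ : lshift q ord0 = ord0); last exact: val_inj.
rewrite (_ : codom _ = codom ((v \o lift j) \o t)); last first.
  apply: eq_codom => k /=; rewrite (_ : rshift 1 k = lift ord0 k); last exact: val_inj.
  by rewrite lift_perm_lift.
rewrite lift_perm_id antisymmetric_perm// odd_lift_perm /= signr_addb signr_odd.
have tt : (-1) ^+ t * (-1) ^+ t = 1 :> R by rewrite -signr_addb addbb.
by rewrite -!mulrA; congr (_ * _); rewrite mulrCA (mulrA _ _ (F _)) tt mul1r.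
Qed.

(** The q! permutations with given first two values contribute the same term, and
the remaining factor 2! is the one of [ext2_codom]. *)
Lemma wedge_ext2 (w : V -> V -> R) F q (b : tensor V q) (v : 'I_(2 + q) -> V) :
  (forall x y, w x y = - w y x) ->
  antisymmetric_form F -> (forall u, b u = F (codom u)) ->
  wedge (fun u : 'I_2 -> V => w (u ord0) (u ord_max)) b v = ext2 w F (codom v).
Proof.
move=> w_alt F_alt bE.
have q0 : (2`! * q`!)%:R != 0 :> R by rewrite pnatr_eq0 -lt0n muln_gt0 !fact_gt0.
rewrite /wedge; apply: (mulfI q0); rewrite mulrA divff // mul1r.
rewrite (@sum_perm_lift R q.+1) mulnC natrM -mulrA (mulr_natl _ 2).
rewrite (@ext2_codom _ _ _ _ q)// mulr_sumr; apply: eq_bigr => j _.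
rewrite (@sum_perm_lift R q) mulr_sumr; apply: eq_bigr => k _.
rewrite -card_Sn mulr_natl -sumr_const.
apply: eq_big => [t | t _]; first by rewrite inE.
rewrite bE.
rewrite (_ : lshift q ord0 = ord0); last exact: val_inj.
rewrite (_ : lshift q (ord_max : 'I_2) = lift (ord0 : 'I_q.+2) ord0 :> 'I_q.+2);
  last exact: val_inj.
rewrite (_ : codom _ = codom ((v \o lift j \o lift k) \o t)); last first.
  apply: eq_codom => i /=.
  rewrite (_ : rshift 2 i = lift ord0 (lift ord0 i) :> 'I_q.+2); last exact: val_inj.
  by rewrite !lift_perm_lift.
rewrite lift_perm_id lift_perm_lift lift_perm_id antisymmetric_perm//.
rewrite !odd_lift_perm /= (signr_addb _ (odd j)) (signr_addb _ (odd k)) !signr_odd exprD.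
have tt : (-1) ^+ t * (-1) ^+ t = 1 :> R by rewrite -signr_addb addbb.
by rewrite -!mulrA; do 2!congr (_ * _); rewrite mulrCA (mulrA _ _ (F _)) tt mul1r.
Qed.

End WedgeSequence.

(** * The codimension of the common kernel *)

Section FormRank.
Context {R : numFieldType} {V : vectType R}.
Implicit Types (F : seq V -> R) (s : seq V).

(** F descends to the quotient by K, whose dimension is less than the degree.
The induction contracts F with the first vector x: if x is not in K, the
contracted form is killed by the larger space spanned by K and x. *)
Lemma form_eq0_of_dim F (K : {vspace V}) s :
  antisymmetric_form F -> multilinear_form F ->
  (forall x t, x \in K -> F (x :: t) = 0) ->
  (\dim {:V} < size s + \dim K)%N -> F s = 0.
Proof.
elim: s F K => [|x s IHs] F K F_alt F_lin FK.
  by rewrite ltnNge dimvS ?subvf.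
have [xK|xK] := boolP (x \in K); first by rewrite FK.
move=> dimK; apply: (IHs (contr x F) (K + <[x]>)%VS).
- exact: antisymmetric_contr.
- exact: multilinear_contr.
- (* On u + a x with u in K, the u part dies after one swap and the x part by
     antisymmetry. *)
  move=> y t /memv_addP[u uK [_ /vlineP[a ->] ->]].
  rewrite /contr addrC (F_lin [:: x]) /= (F_alt [::] x u) /= (FK u) // oppr0 addr0.
  have /eqP := F_alt [::] x x t; rewrite /= -addr_eq0 -mulr2n mulrn_eq0 /=.
  by move=> /eqP ->; rewrite mulr0.
- rewrite dimv_disjoint_sum; last first.
    apply/eqP; rewrite -subv0; apply/subvP => y; rewrite memv_cap memv0.
    move=> /andP[yK /vlineP[a ya]]; apply: contraNT xK => y0.
    have a0 : a != 0 by apply: contraNneq y0 => a0; rewrite ya a0 scale0r.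
    by rewrite -[x](scalerK a0) -ya memvZ.
  rewrite dim_vline; case: eqP xK => [->|_ _]; first by rewrite mem0v.
  by rewrite addn1 addnS.
Qed.

Lemma common_zeros (thetas : seq {scalar V}) : exists U : {vspace V},
  (forall x, (x \in U) = all (fun theta : {scalar V} => theta x == 0) thetas) /\
  (\dim {:V} <= size thetas + \dim U)%N.
Proof.
elim: thetas => [|theta thetas [U [UE dimU]]].
  by exists fullv; split => // x; rewrite memvf.
pose f : 'Hom(V, R^o) := linfun (theta : V -> R^o).
exists (U :&: lker f)%VS; split=> [x|].
  by rewrite memv_cap memv_ker lfunE /= UE andbC.
apply: (leq_trans dimU); rewrite -(limg_ker_dim f U) /= addSn -addnS -addn1 !leq_add2l.
by apply: (leq_trans (dimvS (subvf _))); rewrite dimvf.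
Qed.

Definition in_form_kernel (alpha : V -> R) (w : V -> V -> R) x :=
  alpha x = 0 /\ forall y, w x y = 0.

Context {w : V -> V -> R}.
Hypothesis w_alt : forall x y, w x y = - w y x.
Hypothesis w_lin : forall y, scalar (w^~ y).

Let w_linr x : scalar (w x).
Proof. by move=> a y z; rewrite w_alt w_lin (w_alt y) (w_alt z); ring. Qed.

Lemma form_pow_antisymmetric k : antisymmetric_form (form_pow w k).
Proof.
elim: k => [|k IHk]; last exact: antisymmetric_ext2.
by move=> s x y t; rewrite /form_pow /= /unit_form; case: s => [|z s]; rewrite oppr0.
Qed.

Lemma form_pow_multilinear k : multilinear_form (form_pow w k).
Proof.
elim: k => [|k IHk]; last exact: multilinear_ext2.
by move=> s a x y t; case: s => [|z s]; rewrite /form_pow /= /unit_form /= mulr0 addr0.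
Qed.

Lemma form_pow_kernel k x s : (forall y, w x y = 0) -> form_pow w k (x :: s) = 0.
Proof.
by case: k => [//|k] wx; rewrite contr_form_pow ext1_eq0 ?mulr0// => y _.
Qed.

(** By [form_eq0_of_dim] with K = 0, a power of degree larger than the dimension
vanishes, so there is a last nonzero power. *)
Lemma form_rank_exists : exists m s,
  form_pow w m s <> 0 /\ forall t, form_pow w m.+1 t = 0.
Proof.
have pow_eq0 k s : (\dim {:V} < k)%N -> form_pow w k s = 0.
  move=> dimk; have [sk|] := eqVneq (size s) (k * 2)%N; last exact: form_pow_size.
  apply: (form_eq0_of_dim (K := 0%VS)).
  - exact: form_pow_antisymmetric.
  - exact: form_pow_multilinear.
  - move=> x t; rewrite memv0 => /eqP ->.
    have := form_pow_multilinear k [::] 1 0 0 t.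
    rewrite scaler0 addr0 mul1r /= => /eqP.
    by rewrite eq_sym -subr_eq0 addrK => /eqP.
  - by rewrite sk dimv0 addn0 muln2 -addnn ltn_addr.
pose P k := `[< exists s, form_pow w k s <> 0 >].
have P0 : exists k, P k.
  by exists 0%N; apply/asboolP; exists [::]; apply/eqP; rewrite oner_eq0.
have Pmax k : P k -> (k <= \dim {:V})%N.
  by move=> /asboolP[s]; rewrite leqNgt => Fs; apply/negP => /pow_eq0.
have [m /asboolP[s Fs] mmax] := ex_maxnP P0 Pmax.
exists m, s; split => // t; apply: contrapT => Ft.
by have := mmax m.+1; rewrite ltnn => /(_ _)/negP; apply => //; apply/asboolP; exists t.
Qed.

(** Contracting theta ^ w^k = 0 with x, where theta(x) <> 0, shows that w^k is a
multiple of k theta ^ w_x ^ w^(k-1); multiplying by w produces the factor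
theta ^ w^k = 0. *)
Lemma ext1_form_pow_eq0 (theta : V -> R) x k : theta x != 0 ->
  (forall s, ext1 theta (form_pow w k) s = 0) -> forall s, form_pow w k.+1 s = 0.
Proof.
move=> thx theta_pow s.
have powE t : theta x * form_pow w k t = ext1 theta (contr x (form_pow w k)) t.
  by have /= /eqP := theta_pow (x :: t); rewrite subr_eq0 => /eqP.
apply: (mulfI thx); rewrite mulr0 -[form_pow w k.+1 s]/(ext2 w _ s) -ext2Zr.
rewrite (funext powE); case: k theta_pow {powE} => [|k] theta_pow.
  by rewrite (_ : contr x _ = fun=> 0)// ext2_ext1 (funext (ext2_0r _)) ext1_0r.
rewrite (_ : contr x _ = fun t => k.+1%:R * ext1 (w x) (form_pow w k) t); last first.
  by apply/funext => t; apply: contr_form_pow.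
rewrite ext2_ext1 (funext (ext2Zr _ _ _)) ext1Zr (funext (ext2_ext1 _ _ _)).
by rewrite ext1_anticomm (funext theta_pow) ext1_0r oppr0 mulr0.
Qed.

Context {alpha : {scalar V}}.

Section Rank.
Context {m : nat} {s : seq V}.
Hypothesis powm : form_pow w m s <> 0.
Hypothesis powm1 : forall t, form_pow w m.+1 t = 0.

(** Evaluate w_x ^ w^m = 0, which is the contraction of w^(m+1) with x, on y
followed by s: the orthogonality of x to s leaves only w(x, y) w^m(s). *)
Lemma form_rank_kernel x : {in s, forall y, w x y = 0} -> forall y, w x y = 0.
Proof.
move=> wx y; have /eqP := powm1 (x :: y :: s).
rewrite contr_form_pow mulf_eq0 pnatr_eq0 /= (ext1_eq0 _ wx) subr0 mulf_eq0.
by move=> /orP[/eqP//|/eqP].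
Qed.

Lemma size_rank : size s = (m * 2)%N.
Proof. by apply/eqP/contraT => /form_pow_size - /(_ w). Qed.

Let w_scalar y : {scalar V} :=
  HB.pack (w y) (GRing.isLinear.Build _ _ _ _ (w y) (w_linr y)).

Let all_w x : all (fun theta : {scalar V} => theta x == 0) (map w_scalar s) <->
  forall y, w x y = 0.
Proof.
rewrite all_map; split => [/allP wx | wx].
  by apply: form_rank_kernel => y /wx /= /eqP wyx; rewrite w_alt wyx oppr0.
by apply/allP => y _ /=; rewrite w_alt wx oppr0.
Qed.

(** The equations alpha = 0 and w(s_i, .) = 0 cut out the kernel, and
alpha ^ w^m <> 0 forbids a smaller codimension. *)
Lemma codim_form_kernel_odd t : ext1 alpha (form_pow w m) t <> 0 ->
  exists2 U : {vspace V}, (forall x, x \in U <-> in_form_kernel alpha w x) &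
    (\dim U + (2 * m + 1))%N = \dim {:V}.
Proof.
move=> Qt; have [U [UE dimU]] := common_zeros (alpha :: map w_scalar s).
have UK x : x \in U <-> in_form_kernel alpha w x.
  rewrite UE /=; split => [/andP[/eqP ? /all_w]//|[ax wx]].
  by rewrite ax eqxx; apply/all_w.
exists U => //; apply/eqP; rewrite eqn_leq addnC.
have st : size t = (m * 2).+1.
  by apply/eqP/contraT => /(ext1_size alpha (@form_pow_size _ _ w m)).
apply/andP; split; last first.
  by move: dimU; rewrite /= size_map size_rank mulnC addn1.
rewrite mulnC addn1 -st leqNgt; apply/negP => dimt; apply: Qt.
apply: form_eq0_of_dim dimt.
- exact/antisymmetric_ext1/form_pow_antisymmetric.
- exact/multilinear_ext1/form_pow_multilinear.
- move=> x u /UK[ax wx] /=; rewrite ax mul0r sub0r.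
  rewrite (_ : contr x _ = fun=> 0) ?ext1_0r ?oppr0//.
  by apply/funext => v; apply: form_pow_kernel.
Qed.

(** Contracting alpha ^ w^m = 0 with x in the kernel of w gives alpha(x) w^m = 0,
so here the 2m equations w(s_i, .) = 0 suffice. *)
Lemma codim_form_kernel_even : (forall t, ext1 alpha (form_pow w m) t = 0) ->
  exists2 U : {vspace V}, (forall x, x \in U <-> in_form_kernel alpha w x) &
    (\dim U + 2 * m)%N = \dim {:V}.
Proof.
move=> Q0; have [U [UE dimU]] := common_zeros (map w_scalar s).
have UK x : x \in U <-> in_form_kernel alpha w x.
  rewrite UE; split => [/all_w wx|[_ /all_w//]]; split => //.
  have /eqP := Q0 (x :: s); rewrite /= (_ : contr x _ = fun=> 0).
    by rewrite ext1_0r subr0 mulf_eq0 => /orP[/eqP//|/eqP].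
  by apply/funext => v; apply: form_pow_kernel.
exists U => //; apply/eqP; rewrite eqn_leq addnC.
apply/andP; split; last by move: dimU; rewrite size_map size_rank mulnC.
rewrite mulnC -size_rank leqNgt; apply/negP => dims; apply: powm.
apply: form_eq0_of_dim dims.
- exact: form_pow_antisymmetric.
- exact: form_pow_multilinear.
- by move=> x u /UK[_ wx]; apply: form_pow_kernel.
Qed.

End Rank.
End FormRank.

(** * Wedge powers and the class *)

Section TensorKernel.
Context {R : realType} {V : vectType R}.
Context {alpha : {scalar V}} {w : V -> V -> R}.
Hypothesis w_alt : forall x y, w x y = - w y x.
Hypothesis w_lin : forall y, scalar (w^~ y).

Let alphat : tensor V 1 := fun v => alpha (v ord0).
Let wt : tensor V 2 := fun v => w (v ord0) (v ord_max).

(** Tensors of degree k are functions of k vectors, while F is defined on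
sequences of all lengths; outside length k it must be known to vanish. *)
Lemma tensor_eq0 k (a : tensor V k) F : (forall v, a v = F (codom v)) ->
  (forall s, size s != k -> F s = 0) -> a = 0 <-> forall s, F s = 0.
Proof.
move=> aE F0; split=> [a0 s|F_eq0]; last by apply/funext => v; rewrite aE F_eq0.
have [sk|/F0//] := eqVneq (size s) k; rewrite -{k}sk in a aE a0 F0 *.
have -> : s = codom (tnth (in_tuple s)) by rewrite codomE map_tnth_enum.
by rewrite -aE a0.
Qed.

Lemma wedge_powE k v : wedge_pow wt k v = form_pow w k (codom v).
Proof.
elim: k v => [|k IHk] v; first by rewrite codom_ord0.
apply: (@wedge_ext2 _ _ _ _ (k * 2)%N) => //.
exact: form_pow_antisymmetric.
Qed.

Lemma wedge_pow_eq0 k : wedge_pow wt k = 0 <-> forall s, form_pow w k s = 0.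
Proof. exact/tensor_eq0/form_pow_size/wedge_powE. Qed.

Lemma wedge_wedge_pow_eq0 k :
  wedge alphat (wedge_pow wt k) = 0 <-> forall s, ext1 alpha (form_pow w k) s = 0.
Proof.
apply: (tensor_eq0 (F := ext1 alpha (form_pow w k))) => [v|].
  apply: wedge_ext1 => [|u]; last exact: wedge_powE.
  exact: form_pow_antisymmetric.
by apply: ext1_size; apply: form_pow_size.
Qed.

Lemma alphat_eq0 : alphat = 0 <-> forall x, alpha x = 0.
Proof.
split=> [a0 x|a0]; last by apply/funext => v; apply: a0.
by rewrite -[alpha x]/(alphat (fun=> x)) a0.
Qed.

Lemma tensor_kerE :
  (tensor_ker alphat `&` tensor_ker wt)%classic =
  [set x | in_form_kernel alpha w x]%classic.
Proof.
apply/seteqP; split => x [].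
  move=> ax wx; split => [|y].
    have := congr1 (fun f => f (fun=> 0)) ax.
    by rewrite /Defs.interior /alphat /=; rewrite unlift_none.
  have := congr1 (fun f => f (fun=> y)) wx.
  rewrite /Defs.interior /wt /= unlift_none /=.
  by rewrite (_ : ord_max = lift ord0 ord0) ?liftK//; exact: val_inj.
move=> ax wx; split; apply/funext => v.
  by rewrite /Defs.interior /alphat /= unlift_none.
by rewrite /Defs.interior /wt /= unlift_none; apply: wx.
Qed.

Lemma has_codim_unique (A : set V) c d :
  has_codim A c -> has_codim A d -> c = d.
Proof.
move=> [U -> dimU] [W /seteqP[UW WU] dimW].
have {UW WU} UW : U = W by apply/vspaceP => x; apply/idP/idP => [/UW|/WU].
by apply: (@addnI (\dim U)); rewrite dimU UW dimW.
Qed.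

Let kernel := (tensor_ker alphat `&` tensor_ker wt)%classic.

(** A last nonzero power of w always exists and its exponent determines the
codimension, so the uniqueness of the codimension turns [codim_form_kernel_odd]
and [codim_form_kernel_even] into an equivalence. *)
Lemma has_codim_kernel c : has_codim kernel c <-> exists m,
  [/\ wedge_pow wt m <> 0, wedge_pow wt m.+1 = 0 &
      (wedge alphat (wedge_pow wt m) <> 0 /\ c = (2 * m + 1)%N) \/
      (wedge alphat (wedge_pow wt m) = 0 /\ c = (2 * m)%N)].
Proof.
have kernelE m s : form_pow w m s <> 0 -> (forall t, form_pow w m.+1 t = 0) ->
    (wedge alphat (wedge_pow wt m) <> 0 /\ has_codim kernel (2 * m + 1)) \/
    (wedge alphat (wedge_pow wt m) = 0 /\ has_codim kernel (2 * m)).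
  move=> powm powm1; rewrite wedge_wedge_pow_eq0 /kernel tensor_kerE.
  have [Q0|/existsNP[t Qt]] := pselect (forall t, ext1 alpha (form_pow w m) t = 0).
    right; split=> //.
    have [U UK dimU] := codim_form_kernel_even w_alt w_lin powm powm1 Q0.
    by exists U => //; apply/seteqP; split => x /UK.
  left; split=> [/(_ t)//|].
  have [U UK dimU] := codim_form_kernel_odd w_alt w_lin powm powm1 Qt.
  by exists U => //; apply/seteqP; split => x /UK.
split=> [Kc|[m []]].
  have [m [s [powm powm1]]] := form_rank_exists w_alt w_lin.
  exists m; split; first by move=> /wedge_pow_eq0/(_ s).
    exact/wedge_pow_eq0.
  by have [[Q Km]|[Q Km]] := kernelE m s powm powm1; [left|right]; split=> //;
     apply: has_codim_unique Kc Km.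
rewrite wedge_pow_eq0 => /existsNP[s powm] /wedge_pow_eq0 powm1.
by have [[Q Km]|[Q Km]] := kernelE m s powm powm1 => -[[Q' ->]|[Q' ->]].
Qed.

Lemma has_codim_kernel_odd r :
  alphat <> 0 /\ has_codim kernel (2 * r + 1) <->
  wedge alphat (wedge_pow wt r) <> 0 /\ wedge_pow wt r.+1 = 0.
Proof.
rewrite has_codim_kernel; split=> [[_ [m [powm powm1 []]]]|[Qr powr1]].
- by move=> [Qm] /eqP; rewrite eqn_add2r eqn_pmul2l // => /eqP ->.
- by move=> [_] /(congr1 odd); rewrite addn1 /= !oddM.
split=> [/alphat_eq0 alpha0|].
  by apply/Qr/wedge_wedge_pow_eq0 => s; apply: ext1_eq0 => y _.
exists r; split=> //; last by left.
move=> /wedge_pow_eq0 powr; apply/Qr/wedge_wedge_pow_eq0 => s.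
by rewrite (funext powr) ext1_0r.
Qed.

Lemma has_codim_kernel_even r :
  alphat <> 0 /\ has_codim kernel (2 * r + 2) <->
  [/\ alphat <> 0, wedge alphat (wedge_pow wt r.+1) = 0 & wedge_pow wt r.+1 <> 0].
Proof.
have -> : (2 * r + 2 = 2 * r.+1)%N by rewrite mulnS addnC.
rewrite has_codim_kernel; split=> [[a0 [m [powm powm1 []]]]|[a0 Qr powr]].
- by move=> [_] /(congr1 odd); rewrite addn1 oddS !oddM.
- by move=> [Qm] /eqP; rewrite eqn_pmul2l // => /eqP ->.
split=> //; exists r.+1; split=> //; last by right.
(* A form alpha <> 0 with alpha ^ w^(r+1) = 0 forces w^(r+2) = 0, so that r + 1
   is the last exponent. *)
have [x /eqP ax] : exists x, alpha x <> 0 by apply/existsNP => /alphat_eq0.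
by apply/wedge_pow_eq0; apply: (ext1_form_pow_eq0 ax); apply/wedge_wedge_pow_eq0.
Qed.

End TensorKernel.

(** * Bilinearity of the exterior derivative *)

Section ExteriorDerivative.
Context {R : realType} {n : nat} {M : smooth_manifold R n}.
Variables (eta : one_form M) (x : M).

Definition ext_deriv2 (u v : tangent x) : R :=
  ext_deriv eta x (fun i : 'I_2 => if i == ord0 then u else v).

Lemma ext_deriv2_antisymmetric u v : ext_deriv2 u v = - ext_deriv2 v u.
Proof. by rewrite /ext_deriv2 /ext_deriv /= opprB. Qed.

Lemma local_expr_scalar a y : scalar (local_expr eta a y).
Proof. by move=> c u v; rewrite /local_expr !linearP. Qed.

(** The exterior derivative at x antisymmetrizes D_u (eta(v)), which is linear in
u as a differential, and in v because eta is linear at every point of the chart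
and its coefficients are differentiable at x. *)
Lemma ext_deriv2_scalar v : scalar (ext_deriv2^~ v).
Proof.
pose a := chart_at x; pose coef u : 'rV[R]_n -> R^o := fun y => local_expr eta a y u.
pose D u t : R := 'd (coef t) (chart_map a x) u.
have atlas_a : atlas a by rewrite /a /chart_at; case: cid2.
have dom_a : chart_dom a x by rewrite /a /chart_at; case: cid2.
have coef_diff u : differentiable (coef u) (chart_map a x).
  by have [+ _] := form_smooth eta atlas_a u 1; apply; exists x.
have D_linl c u1 u2 t : D (c *: u1 + u2) t = c * D u1 t + D u2 t.
  by rewrite /D linearP.
have D_linr c u t1 t2 : D u (c *: t1 + t2) = c * D u t1 + D u t2.
  have coefE : coef (c *: t1 + t2) = c *: coef t1 + coef t2.
    by apply/funext => y; apply: local_expr_scalar.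
  rewrite /D coefE diffD; [|exact: differentiableZ|exact: coef_diff].
  by rewrite diffZ.
move=> c u1 u2; change (D (c *: u1 + u2) v - D v (c *: u1 + u2) =
  c * (D u1 v - D v u1) + (D u2 v - D v u2)).
rewrite D_linl D_linr; move: (D u1 v) (D u2 v) (D v u1) (D v u2) => p q p' q'.
ring.
Qed.

End ExteriorDerivative.

Unset Implicit Arguments.

Theorem proposition5p2 (R : realType) (n : nat) (M : smooth_manifold R n)
    (eta : one_form M) (r : nat) :
  (precontact_of_class eta (2 * r + 1) <->
   forall x : M,
     wedge (form_tensor eta x) (wedge_pow (ext_deriv eta x) r) <> 0 /\
     wedge_pow (ext_deriv eta x) r.+1 = 0)
  /\
  (precontact_of_class eta (2 * r + 2) <->
   forall x : M,
     [/\ form_tensor eta x <> 0,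
         wedge (form_tensor eta x) (wedge_pow (ext_deriv eta x) r.+1) = 0 &
         wedge_pow (ext_deriv eta x) r.+1 <> 0]).
Proof.
pose w_alt := ext_deriv2_antisymmetric eta.
pose w_lin := ext_deriv2_scalar eta.
have odd_class x := @has_codim_kernel_odd _ _ (eta x) _ (w_alt x) (w_lin x) r.
have even_class x := @has_codim_kernel_even _ _ (eta x) _ (w_alt x) (w_lin x) r.
split; split.
- by move=> [[eta0 _] etac] x; apply/odd_class; split; [exact: eta0|exact: etac].
- move=> etar; have etac x := (odd_class x).2 (etar x).
  by split; [split; [|exists (2 * r + 1)%N]|] => x; have [] := etac x.
- by move=> [[eta0 _] etac] x; apply/even_class; split; [exact: eta0|exact: etac].
- move=> etar; have etac x := (even_class x).2 (etar x).
  by split; [split; [|exists (2 * r + 2)%N]|] => x; have [] := etac x.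
Qed.
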